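(* Let $h>0$. The one-step map $(\mathbf{x}^n,\mathbf{u}^{n-1/2})\mapsto(\mathbf{x}^{n+1},\mathbf{u}^{n+1/2})$ of the explicit leapfrog method, defined by $$\mathbf{M}\bigl(\mathbf{u}^{n+1/2}-\mathbf{u}^{n-1/2}\bigr)=\tfrac h2\,\mathbf{F}(\mathbf{x}^n)\bigl(\mathbf{u}^{n+1/2}+\mathbf{u}^{n-1/2}\bigr),\qquad \mathbf{x}^{n+1}=\mathbf{x}^n+h\,\mathbf{u}^{n+1/2},$$ is volume-preserving.
   Context: Let $\phi:\mathbb{R}^3\to\mathbb{R}$ (scalar potential) and $A:\mathbb{R}^3\to\mathbb{R}^3$ (vector potential) be arbitrarily differentiable, and let $E(x)=-\nabla\phi(x)$, $B(x)=\nabla\times A(x)$. Four-dimensional position vectors are written $\mathbf{x}=(t;x)\in\mathbb{R}\times\mathbb{R}^3$ (as column vectors), four-dimensional momentum vectors $\mathbf{u}=(\gamma;u)\in\mathbb{R}\times\mathbb{R}^3$. Let $\mathbf{M}=\mathrm{diag}(-1,1,1,1)$ and, for $\mathbf{x}=(t;x)$, $$\mathbf{F}(\mathbf{x})=\begin{pmatrix}0&-E(x)^\top\\ E(x)&-\widehat B(x)\end{pmatrix}\in\mathbb{R}^{4\times4},$$ where $\widehat B(x)$ is the $3\times3$ matrix with $\widehat B(x)v=B(x)\times v$ for all $v\in\mathbb{R}^3$; $\mathbf{F}(\mathbf{x})$ is skew-symmetric. The one-step map is defined at those $(\mathbf{x}^n,\mathbf{u}^{n-1/2})\in\mathbb{R}^4\times\mathbb{R}^4$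 for which the linear system for $\mathbf{u}^{n+1/2}$ is uniquely solvable, i.e. $\mathbf{M}-\tfrac h2\mathbf{F}(\mathbf{x}^n)$ is invertible. A map $\Phi$ on (an open subset of) $\mathbb{R}^8$ is volume-preserving if $\mathrm{vol}(\Phi(\Omega))=\mathrm{vol}(\Omega)$ for every bounded open set $\Omega\subset\mathbb{R}^8$ on which $\Phi$ is defined. *)

(* Defs.v *)
From HB Require Import structures.
From mathcomp Require Import all_boot all_order all_algebra.
From mathcomp Require Import all_classical all_reals all_analysis.

Set Implicit Arguments.
Unset Strict Implicit.
Unset Printing Implicit Defensive.

Import Order.TTheory GRing.Theory Num.Theory.
Import numFieldNormedType.Exports.

Local Open Scope classical_set_scope.
Local Open Scope ring_scope.

(* Components of vectors of R^3 are indexed by 'I_3, whose addition is modulo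
   3, so that i + 1 and i + 2 are the two indices cyclically following i. *)
Definition crossv (R : realType) (a b : 'cV[R]_3) : 'cV[R]_3 :=
  \col_(i < 3) (a (i + 1) 0 * b (i + 2%:R) 0 - a (i + 2%:R) 0 * b (i + 1) 0).

Definition hatmx (R : realType) (b : 'cV[R]_3) : 'M[R]_3 :=
  \matrix_(i < 3, j < 3) crossv b (delta_mx j 0) i 0.

Lemma hatmxE (R : realType) (b v : 'cV[R]_3) : hatmx b *m v = crossv b v.
Proof.
apply/colP => i; rewrite !mxE (bigD1 (i + 1)) //= (bigD1 (i + 2%:R)) /=; last first.
  by case: i => -[|[|[|]]].
rewrite big1 => [|j]; last first.
  rewrite !mxE andbC => /andP[/negPf j2 /negPf j1].
  by rewrite [_ + 2%:R == j]eq_sym j2 [_ + 1 == j]eq_sym j1 !mulr0 subrr mul0r.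
rewrite !mxE !eqxx !andbT.
have -> : (i + 2%:R == i + 1) = false by case: i => -[|[|[|]]].
have -> : (i + 1 == i + 2%:R) = false by case: i => -[|[|[|]]].
by rewrite !mulr0 !mulr1 sub0r subr0 addr0 mulNr addrC.
Qed.

Definition partial (R : realType) (j : 'I_3) (f : 'cV[R]_3 -> R) (x : 'cV[R]_3)
    : R := 'D_(delta_mx j 0) (f : 'cV[R]_3 -> R^o) x.

Definition grad (R : realType) (f : 'cV[R]_3 -> R) (x : 'cV[R]_3) : 'cV[R]_3 :=
  \col_(i < 3) partial i f x.

Definition curl (R : realType) (f : 'cV[R]_3 -> 'cV[R]_3) (x : 'cV[R]_3)
    : 'cV[R]_3 :=
  \col_(i < 3) (partial (i + 1) (fun y => f y (i + 2%:R) 0) x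
                - partial (i + 2%:R) (fun y => f y (i + 1) 0) x).

(* All iterated directional derivatives, of every order, are (Frechet)
   differentiable everywhere. *)
Definition smooth (R : realType) (V W : normedModType R) (f : V -> W) : Prop :=
  forall (s : seq V) (x : V),
    differentiable (foldr (fun v g y => 'D_v g y) f s) x.

(* A point of R^8 is a pair (position, momentum). *)
Local Notation phase R := ('cV[R]_(1 + 3) * 'cV[R]_(1 + 3))%type.

Section Leapfrog.
Variables (R : realType) (phi : 'cV[R]_3 -> R) (A : 'cV[R]_3 -> 'cV[R]_3).

Definition Efield (x : 'cV[R]_3) : 'cV[R]_3 := - grad phi x.
Definition Bfield (x : 'cV[R]_3) : 'cV[R]_3 := curl A x.

Definition Mmx : 'M[R]_(1 + 3) := diag_mx (row_mx (const_mx (-1)) (const_mx 1)).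

Definition Fmx (x : 'cV[R]_(1 + 3)) : 'M[R]_(1 + 3) :=
  block_mx 0 (- (Efield (dsubmx x))^T)
           (Efield (dsubmx x)) (- hatmx (Bfield (dsubmx x))).

Definition leapfrog_step (h : R) (p q : phase R) : Prop :=
  Mmx *m (q.2 - p.2) = (h / 2) *: (Fmx p.1 *m (q.2 + p.2)) /\
  q.1 = p.1 + h *: q.2.

Definition leapfrog_dom (h : R) : set (phase R) :=
  [set p | Mmx - (h / 2) *: Fmx p.1 \in unitmx].

(* On [leapfrog_dom h] the point q with [leapfrog_step h p q] is unique;
   elsewhere the value of [leapfrog h p] is irrelevant. *)
Definition leapfrog (h : R) (p : phase R) : phase R :=
  get [set q | leapfrog_step h p q].

End Leapfrog.

Section Volume.
Variable R : realType.

Local Notation leb := (@lebesgue_measure R).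
Local Notation R4 := (measurableTypeR R * measurableTypeR R * measurableTypeR R
                      * measurableTypeR R)%type.

Definition leb4 : set R4 -> \bar R := (leb \x leb \x leb \x leb)%E.

HB.instance Definition _ := Measure.on leb4.

Let leb4_sigma_finite : sigma_finite setT leb4.
Proof.
have /sigma_finiteP[F [TF ndF Foo]] := sigma_finiteT leb.
exists (fun n => F n `*` F n `*` F n `*` F n).
  apply/esym; rewrite -subTset => -[[[a b] c] d] _.
  have FT x : exists n, F n x by have : setT x by []; rewrite TF => -[n _]; exists n.
  have [[i Fi] [j Fj] [k Fk] [l Fl]] := And4 (FT a) (FT b) (FT c) (FT d).
  pose n := (i + j + k + l)%N.
  have sub m : (m <= n)%N -> F m `<=` F n by move=> mn; exact/subsetPset/ndF.
  exists n => //; split; [split; [split|]|] => /=.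
  - by apply: (sub i) => //; rewrite /n -!addnA leq_addr.
  - by apply: (sub j) => //; rewrite /n -!addnA addnCA leq_addr.
  - by apply: (sub k) => //; rewrite /n addnAC leq_addl.
  - by apply: (sub l) => //; rewrite /n leq_addl.
move=> n; have [mF Fn] := Foo n.
have fF : leb (F n) \is a fin_num by rewrite ge0_fin_numE.
have m2 := measurableX mF mF; have m3 := measurableX m2 mF.
split; first exact: measurableX.
rewrite /leb4 (product_measure1E (leb \x leb \x leb)%E leb)//=.
rewrite (product_measure1E (leb \x leb)%E leb)//= (product_measure1E leb leb)//=.
by rewrite -ge0_fin_numE ?mule_ge0// !fin_numM.
Qed.

HB.instance Definition _ :=
  Measure_isSigmaFinite.Build _ _ _ leb4 leb4_sigma_finite.

Definition coords (v : 'cV[R]_(1 + 3)) : R4 :=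
  (v 0 0, v 1 0, v 2%:R 0, v 3%:R 0).

(* 8-dimensional Lebesgue (outer) measure: the outer extension of the product
   measure is defined for all subsets and agrees with it on the Borel ones. *)
Definition vol (S : set (phase R)) : \bar R :=
  mu_ext (leb4 \x leb4)%E [set (coords p.1, coords p.2) | p in S].

(* [Phi] is regarded as a partial map with domain [D]. *)
Definition volume_preserving (D : set (phase R)) (Phi : phase R -> phase R)
    : Prop :=
  forall Omega, open Omega -> bounded_set Omega -> Omega `<=` D ->
    vol (Phi @` Omega) = vol Omega.

End Volume.

(* Main.v *)
(* The map factors as (x, u) |-> (x, C(x) u) |-> (x + h C(x) u, C(x) u), where
   C(x) = (M - K)^-1 (M + K) is the Cayley transform of K = (h/2) F(x). As M is
   symmetric and F(x) skew, M + K is the transpose of M - K and det C(x) = 1.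
   By Fubini's theorem a map acting on the fibres of a product by
   measure-preserving maps preserves the product measure: the second factor
   acts by translations, and the first one by elements of SL_4, which are
   products of transvections, i.e. of translations of a single coordinate by a
   function of the others. The volume of an image is computed as that of a
   preimage by the inverse map, which is everywhere defined once C(x) is
   replaced by 1 where it does not exist. *)

Require Import Defs.
From HB Require Import structures.
From mathcomp Require Import all_boot all_order all_algebra.
From mathcomp Require Import all_classical all_reals all_analysis.
From mathcomp Require Import measurable_realfun.

Set Implicit Arguments.
Unset Strict Implicit.
Unset Printing Implicit Defensive.

Import Order.TTheory GRing.Theory Num.Theory.
Import numFieldNormedType.Exports.

Local Open Scope classical_set_scope.
Local Open Scope ring_scope.

(** * Generation of the special linear group by transvections *)

Lemma det_transvection (F : comNzRingType) (n : nat) (i j : 'I_n) (a : F) :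
  i != j -> \det (1%:M + a *: delta_mx i j) = 1.
Proof.
(* Transposition exchanges [i] and [j], so the matrix may be taken lower triangular, with unit
   diagonal. *)
wlog ji : i j / (j < i)%N => [wlg ij|ij].
  have [ji|] := ltnP j i; first exact: wlg.
  rewrite leq_eqVlt (inj_eq val_inj) (negPf ij)/= => ji.
  by rewrite -det_tr linearD linearZ/= trmx1 trmx_delta wlg// eq_sym.
rewrite det_trig.
  apply: big1 => k _; rewrite !mxE eqxx [_ && _](_ : _ = false) ?mulr0 ?addr0//.
  by apply/negP => /andP[/eqP -> /eqP ij']; rewrite ij' eqxx in ij.
apply/is_trig_mxP => k l kl; rewrite !mxE.
rewrite -(inj_eq val_inj) (ltn_eqF kl) [_ && _](_ : _ = false) ?mulr0 ?addr0//.
by apply/negP => /andP[/eqP ki /eqP lj]; move: kl; rewrite ki lj ltnNge ltnW.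
Qed.

(** Gaussian elimination by induction on the size: row operations bring the upper left entry to 1,
    and a block LDU factorization then leaves a Schur complement of determinant 1 and smaller
    size. *)
Lemma SL_transvection_ind (F : fieldType) (n : nat) (P : 'M[F]_n -> Prop) :
  P 1%:M -> (forall A B, P A -> P B -> P (A *m B)) ->
  (forall i j a, i != j -> P (1%:M + a *: delta_mx i j)) ->
  forall A, \det A = 1 -> P A.
Proof.
elim: n P => [|n IHn] P P1 PM Pt A detA.
  by rewrite flatmx0 -(flatmx0 1%:M).
rewrite -[n.+1]/(1 + n)%N in P P1 PM Pt A detA *.
(* Row operations can be undone: as [delta_mx i j] squares to 0 for [i != j], the transvection with
   [- a] is the inverse of the one with [a]. *)
have Pul (E : 'M[F]_(1 + n)) i j a : i != j ->
    P ((1%:M + a *: delta_mx i j) *m E) -> P E.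
  move=> ij /(PM _ _ (Pt i j (- a) ij)).
  rewrite mulmxA mulmxDl mul1mx mulmxDr mulmx1.
  rewrite -scalemxAr -scalemxAl mul_delta_mx_0 1?eq_sym// !scaler0 addr0.
  by rewrite scaleNr addrK mul1mx.
(* Multiplying such block matrices adds their columns [c], so splitting [c] into its entries gives a
   product of transvections. The same holds for [Pu] with rows. *)
have Pl (c : 'cV[F]_n) : P (block_mx 1%:M 0 c 1%:M).
  rewrite (matrix_sum_delta c).
  apply: (big_ind (fun c => P (block_mx 1%:M 0 c 1%:M))) => [|x y Px Py|i _].
  - by rewrite -scalar_mx_block.
  - have := PM _ _ Px Py.
    by rewrite mulmx_block !mulmx1 !mul1mx !mulmx0 !mul0mx !addr0 add0r.
  rewrite big_ord1.
  suff -> : block_mx 1%:M 0 (c i 0 *: delta_mx i 0) 1%:M =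
     1%:M + c i 0 *: delta_mx (rshift 1 i) (lshift n 0) by exact: Pt.
  rewrite [1%:M in RHS]scalar_mx_block.
  have -> : delta_mx (rshift 1 i) (lshift n 0) =
      block_mx 0 0 (delta_mx i 0) 0 :> 'M[F]_(1 + n).
    by rewrite delta_mx_dshift delta_mx_lshift /block_mx !row_mx0.
  by rewrite scale_block_mx add_block_mx !scaler0 !addr0 add0r.
have Pu (r : 'rV[F]_n) : P (block_mx 1%:M r 0 1%:M).
  rewrite (matrix_sum_delta r) big_ord1.
  apply: (big_ind (fun r => P (block_mx 1%:M r 0 1%:M))) => [|x y Px Py|i _].
  - by rewrite -scalar_mx_block.
  - have := PM _ _ Px Py.
    rewrite mulmx_block !mulmx1 !mul1mx !mulmx0 !mul0mx !addr0 add0r.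
    by rewrite addrC.
  suff -> : block_mx 1%:M (r 0 i *: delta_mx 0 i) 0 1%:M =
     1%:M + r 0 i *: delta_mx (lshift n 0) (rshift 1 i) by exact: Pt.
  rewrite [1%:M in RHS]scalar_mx_block.
  have -> : delta_mx (lshift n 0) (rshift 1 i) =
      block_mx 0 (delta_mx 0 i) 0 0 :> 'M[F]_(1 + n).
    by rewrite delta_mx_ushift delta_mx_rshift /block_mx !row_mx0.
  by rewrite scale_block_mx add_block_mx !scaler0 !addr0 add0r.
have Pd (B : 'M[F]_n) : \det B = 1 -> P (block_mx 1%:M 0 0 B).
  apply: (IHn (fun B => P (block_mx 1%:M 0 0 B))) => [|x y Px Py|i j a ij].
  - by rewrite -scalar_mx_block.
  - have := PM _ _ Px Py.
    by rewrite mulmx_block !mulmx1 !mulmx0 !mul0mx !addr0 add0r.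
  suff -> : block_mx 1%:M 0 0 (1%:M + a *: delta_mx i j) =
     1%:M + a *: delta_mx (rshift 1 i) (rshift 1 j).
    by apply: Pt; rewrite (inj_eq (@rshift_inj _ _)).
  rewrite [1%:M in RHS]scalar_mx_block.
  have -> : delta_mx (rshift 1 i) (rshift 1 j) =
      block_mx 0 0 0 (delta_mx i j) :> 'M[F]_(1 + n).
    by rewrite delta_mx_dshift delta_mx_rshift /block_mx !row_mx0.
  by rewrite scale_block_mx add_block_mx !scaler0 !addr0.
(* The factorization is [E = L * diag(1, S) * U] with [S] the Schur complement of the entry 1; the
   unipotent factors have determinant 1, hence so has [S]. *)
have P00 (E : 'M[F]_(1 + n)) : \det E = 1 -> E 0 0 = 1 -> P E.
  move=> detE E00; pose r := ursubmx E; pose c := dlsubmx E.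
  have Edef : E = block_mx 1%:M 0 c 1%:M *m
      block_mx 1%:M 0 0 (drsubmx E - c *m r) *m block_mx 1%:M r 0 1%:M.
    have ulE : ulsubmx E = 1%:M.
      apply/matrixP => i j; rewrite !ord1 !mxE -E00.
      by congr (E _ _); apply: val_inj.
    rewrite !mulmx_block !mulmx1 !mul1mx !mulmx0 !mul0mx !addr0 !add0r.
    by rewrite (addrC (c *m r)) subrK mul1mx -[LHS]submxK ulE.
  rewrite Edef; apply: (PM _ _ _ (Pu _)); apply: (PM _ _ (Pl _) (Pd _ _)).
  move: detE; rewrite {1}Edef !det_mulmx det_lblock !det_ublock.
  by rewrite !det1 !mulr1 !mul1r.
have det_t (E : 'M[F]_(1 + n)) i j a :
    i != j -> \det ((1%:M + a *: delta_mx i j) *m E) = \det E.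
  by move=> ij; rewrite det_mulmx det_transvection// mul1r.
have tE (E : 'M[F]_(1 + n)) i j a k l :
    ((1%:M + a *: delta_mx i j) *m E) k l = E k l + a * (k == i)%:R * E j l.
  rewrite mulmxDl mul1mx mxE; congr (_ + _).
  rewrite -scalemxAl mxE -mulrA; congr (_ * _); rewrite mxE (bigD1 j)//= big1.
    by rewrite mxE eqxx andbT addr0.
  by move=> m /negPf mj; rewrite mxE mj andbF mul0r.
(* Adding [(1 - E 0 0) / E i 0] times row [i] to row 0 turns the upper left entry into 1. *)
have Pcol (E : 'M[F]_(1 + n)) i : \det E = 1 -> i != 0 -> E i 0 != 0 -> P E.
  move=> detE i0 Ei0; apply: (Pul E 0 i ((1 - E 0 0) / E i 0)).
    by rewrite eq_sym.
  apply: P00; first by rewrite det_t// eq_sym.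
  by rewrite tE eqxx mulr1 mulfVK// addrC subrK.
have [/existsP[i /andP[i0 Ai0]]|] := boolP [exists i, (i != 0) && (A i 0 != 0)].
  exact: Pcol Ai0.
rewrite negb_exists => /forallP A0.
(* In the remaining case the first column vanishes below its top entry, which must then be nonzero
   because it divides the determinant. *)
have A00 : \det A = A 0 0 * cofactor A 0 0.
  rewrite (expand_det_col _ 0) (bigD1 0)//= big1 ?addr0// => i i0.
  by have := A0 i; rewrite i0 negbK => /eqP ->; rewrite mul0r.
have A00N : A 0 0 != 0.
  by apply/eqP => A00N; move/eqP: A00; rewrite detA A00N mul0r oner_eq0.
clear IHn.
case: n => [|n]
  in P P1 PM Pt A detA Pul Pl Pu Pd P00 det_t tE Pcol A0 A00 A00N *.
  by apply: P00; rewrite // -detA (det_mx11 A).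
have n10 : (1 : 'I_(1 + n.+1)) != 0 by [].
(* Adding row 0 to row 1 copies the nonzero [A 0 0] below the top of the column, which is the
   situation of [Pcol]. In size one, treated just before, the entry is the determinant itself. *)
apply: (Pul A 1 0 1) => //; apply: (Pcol _ 1); rewrite ?det_t//.
rewrite tE eqxx !mul1r.
by have := A0 1; rewrite n10 negbK => /eqP ->; rewrite add0r.
Qed.

(** * Measure-preserving maps and fibrewise action on products *)

Definition preserving d (T : measurableType d) (R : realType)
    (mu : set T -> \bar R) (f : T -> T) : Prop :=
  measurable_fun setT f /\ forall A, measurable A -> mu (f @^-1` A) = mu A.

Lemma measurable_preimage d d' (T : measurableType d) (U : measurableType d')
    (f : T -> U) (A : set U) :
  measurable_fun setT f -> measurable A -> measurable (f @^-1` A).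
Proof. by move=> mf mA; rewrite -[X in measurable X]setTI; exact: mf. Qed.

Lemma preserving_comp d (T : measurableType d) (R : realType)
    (mu : set T -> \bar R) (f g : T -> T) :
  preserving mu f -> preserving mu g -> preserving mu (f \o g).
Proof.
move=> [mf pf] [mg pg]; split; first exact: measurableT_comp.
by move=> A mA; rewrite comp_preimage pg ?pf//; exact: measurable_preimage.
Qed.

Section fibers.
Context d1 d2 (T1 : measurableType d1) (T2 : measurableType d2) (R : realType).
Variable m1 : {sigma_finite_measure set T1 -> \bar R}.
Variable m2 : {sigma_finite_measure set T2 -> \bar R}.

(* [product_measure1] itself is canonically sigma-finite only for subprobability
   measures. *)
Definition prodm : set (T1 * T2) -> \bar R := (m1 \x m2)%E.

HB.instance Definition _ := Measure.on prodm.

Let product_sigma_finite : sigma_finite setT prodm.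
Proof.
have /sigma_finiteP[F [TF ndF Foo]] := sigma_finiteT m1.
have /sigma_finiteP[G [TG ndG Goo]] := sigma_finiteT m2.
exists (fun n => F n `*` G n).
  apply/esym; rewrite -subTset => -[x y] _.
  have [n _ Fx] : (\bigcup_n F n) x by rewrite -TF.
  have [k _ Gy] : (\bigcup_n G n) y by rewrite -TG.
  exists (maxn n k) => //; split => /=.
    by apply: (subsetPset _ _ (ndF _ _ (leq_maxl n k))).
  by apply: (subsetPset _ _ (ndG _ _ (leq_maxr n k))).
move=> k; have [mF Fk] := Foo k; have [mG Gk] := Goo k.
split; first exact: measurableX.
by rewrite /prodm product_measure1E// lte_mul_pinfty// ge0_fin_numE.
Qed.

HB.instance Definition _ :=
  Measure_isSigmaFinite.Build _ _ _ prodm product_sigma_finite.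

(** The two iterated integrals agree on rectangles, hence on all measurable sets by uniqueness of
    the product measure. This gives access to sections in either direction. *)
Lemma product_measure12 (A : set (T1 * T2)) :
  measurable A -> (m1 \x m2)%E A = (m1 \x^ m2)%E A.
Proof.
by apply: product_measure_unique => B C mB mC; exact: product_measure2E.
Qed.

(** The section at [x] of the preimage of [A] is the preimage, under the map of the fibre over [x],
    of the section of [A]; so the integrands defining the two measures coincide. *)
Lemma preserving_snd (f : T1 * T2 -> T2) : measurable_fun setT f ->
  (forall x, preserving m2 (fun y => f (x, y))) ->
  preserving (m1 \x m2)%E (fun p => (p.1, f p)).
Proof.
move=> mf pf; split=> [|A mA].
  exact: measurable_fun_pair measurable_fst mf.
apply: eq_integral => x _ /=.
rewrite -[RHS](pf x).2; last exact: measurable_xsection.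
by congr (m2 _); apply/seteqP; split=> y; rewrite /xsection/= !inE.
Qed.

Lemma preserving_fst (f : T1 * T2 -> T1) : measurable_fun setT f ->
  (forall y, preserving m1 (fun x => f (x, y))) ->
  preserving (m1 \x m2)%E (fun p => (f p, p.2)).
Proof.
move=> mf pf; have mF : measurable_fun setT (fun p => (f p, p.2)).
  exact: measurable_fun_pair mf measurable_snd.
split=> // A mA.
rewrite !product_measure12//; last exact: measurable_preimage.
apply: eq_integral => y _ /=.
rewrite -[RHS](pf y).2; last exact: measurable_ysection.
by congr (m1 _); apply/seteqP; split=> x; rewrite /ysection/= !inE.
Qed.
End fibers.

(** * Translations, shears and determinant-one linear maps of R^4 *)

Lemma preserving_translation (R : realType) (c : R) :
  preserving (@lebesgue_measure R)
    (fun x : measurableTypeR R => x + c : measurableTypeR R).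
Proof.
have mc : measurable_fun setT
    (fun x : measurableTypeR R => x + c : measurableTypeR R).
  exact: measurable_funD.
split=> // A mA.
(* The push-forward by the translation gives []a, b]] the length of []a - c, b - c]], which is the
   same; uniqueness of Lebesgue measure concludes. *)
rewrite [RHS](@lebesgue_measure_unique _
  (measure_function_pushforward__canonical__measure_function_Measure
    lebesgue_measure mc))//.
move=> X [[a b] _ <-] /=.
rewrite /pushforward.
rewrite (_ : _ @^-1` _ = `]a - c, b - c]%classic).
  rewrite !lebesgue_measure_itv/= !lte_fin ltrD2r.
  by case: ifPn => // _; congr (_%:E); rewrite opprB addrA subrK.
by apply/seteqP; split=> y /=; rewrite !in_itv/= ltrBlDr lerBrDr.
Qed.

Section shear.
Variable R : realType.
Local Notation leb := (@lebesgue_measure R).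
Local Notation R1 := (measurableTypeR R).
Local Notation R4 := (R1 * R1 * R1 * R1)%type.

Definition decoords (p : R4) : 'cV[R]_(1 + 3) :=
  \col_(i < 1 + 3) nth 0 [:: p.1.1.1; p.1.1.2; p.1.2; p.2] i.

Lemma coordsK : cancel (@coords R) decoords.
Proof.
move=> v; apply/colP => i; rewrite mxE.
by case: i => [[|[|[|[|//]]]] ?] /=; congr (v _ _); apply: val_inj.
Qed.

Lemma decoordsK : cancel decoords (@coords R).
Proof. by move=> [[[a b] c] d]; rewrite /coords !mxE. Qed.

Lemma measurable_decoords i :
  measurable_fun setT (fun p => decoords p i 0 : R1).
Proof.
case: i => [[|[|[|[|//]]]] ilt]; under eq_fun do rewrite mxE /=.
- exact: measurableT_comp measurable_fst
    (measurableT_comp measurable_fst measurable_fst).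
- exact: measurableT_comp measurable_snd
    (measurableT_comp measurable_fst measurable_fst).
- exact: measurableT_comp measurable_snd measurable_fst.
- exact: measurable_snd.
Qed.

Lemma measurable_coords d (T : measurableType d) (f : T -> 'cV[R]_(1 + 3)) :
  (forall i, measurable_fun setT (fun t => f t i 0 : R1)) ->
  measurable_fun setT (fun t => coords (f t)).
Proof. by move=> mf; do 3 apply: measurable_fun_pair => //. Qed.

(** This is the form that a shear takes on a line parallel to its axis. *)
Lemma preserving_shear1 (g : R1 -> R1) : (forall y, g y = g 0) ->
  preserving leb (fun y => y + g y : R1).
Proof.
move=> g0; rewrite [fun y => _](_ : _ = fun y => y + g 0); last first.
  by apply/funext => y; rewrite g0.
exact: preserving_translation.
Qed.

(** The second hypothesis expresses that [g] does not depend on coordinate [i]. With the other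
    coordinates frozen the map is a translation of a line, and the fibre lemmas carry this up
    through the nested pairs. *)
Lemma preserving_shear (i : 'I_(1 + 3)) (g : R4 -> R1) :
  measurable_fun setT g ->
  (forall p t, g (coords (decoords p + t *: delta_mx i 0)) = g p) ->
  preserving (@leb4 R) (fun p => coords (decoords p + g p *: delta_mx i 0)).
Proof.
move=> mg gi.
have m111 : measurable_fun setT (fun p : R4 => p.1.1.1).
  exact: measurableT_comp measurable_fst
    (measurableT_comp measurable_fst measurable_fst).
have m112 : measurable_fun setT (fun p : R4 => p.1.1.2).
  exact: measurableT_comp measurable_snd
    (measurableT_comp measurable_fst measurable_fst).
have m12 : measurable_fun setT (fun p : R4 => p.1.2).
  exact: measurableT_comp measurable_snd measurable_fst.
have n11 : measurable_fun setT (fun p : R1 * R1 * R1 => p.1.1).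
  exact: measurableT_comp measurable_fst measurable_fst.
have n12 : measurable_fun setT (fun p : R1 * R1 * R1 => p.1.2).
  exact: measurableT_comp measurable_snd measurable_fst.
have m3 (d : R1) : measurable_fun setT (fun p => g (p, d)).
  exact: measurable_fun_pair1.
have m2 (c d : R1) : measurable_fun setT (fun p => g (p, c, d)).
  exact: measurable_fun_pair1 (m3 d).
have m1 (b c d : R1) : measurable_fun setT (fun a => g (a, b, c, d)).
  exact: measurable_fun_pair1 (m2 c d).
(* Pairs nest to the left, so coordinate 0 is reached through three first factors, and each later
   coordinate through a second factor after fewer first ones. *)
case: i gi => [[|[|[|[|//]]]] ilt] gi.
- rewrite [fun p => _](_ : _ =
      fun p => ((p.1.1.1 + g p, p.1.1.2, p.1.2), p.2)); last first.
    apply/funext => -[[[a b] c] d].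
    by rewrite /coords !mxE/= !mulr1 !mulr0 !addr0.
  apply: (@preserving_fst _ _ _ _ _ (prodm (prodm leb leb) leb) leb
    (fun p => (p.1.1.1 + g p, p.1.1.2, p.1.2))) => [|d /=].
    do 2 apply: measurable_fun_pair => //.
    exact: measurable_funD m111 mg.
  apply: (@preserving_fst _ _ _ _ _ (prodm leb leb) leb
    (fun p => (p.1.1 + g (p, d), p.1.2))) => [|c /=].
    by apply: measurable_fun_pair => //; exact: measurable_funD n11 (m3 d).
  apply: (@preserving_fst _ _ _ _ _ leb leb
    (fun p => p.1 + g (p, c, d))) => [|b /=].
    exact: measurable_funD measurable_fst (m2 c d).
  apply: (preserving_shear1 (g := fun a => g (a, b, c, d))) => a.
  (* Moving by [- a] along the axis sends the coordinate [a] to 0. *)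
  by rewrite -(gi _ (- a)) /coords !mxE/= !mulr1 !mulr0 !addr0 subrr.
- rewrite [fun p => _](_ : _ =
      fun p => ((p.1.1.1, p.1.1.2 + g p, p.1.2), p.2)); last first.
    apply/funext => -[[[a b] c] d].
    by rewrite /coords !mxE/= !mulr1 !mulr0 !addr0.
  apply: (@preserving_fst _ _ _ _ _ (prodm (prodm leb leb) leb) leb
    (fun p => (p.1.1.1, p.1.1.2 + g p, p.1.2))) => [|d /=].
    do 2 apply: measurable_fun_pair => //.
    exact: measurable_funD m112 mg.
  apply: (@preserving_fst _ _ _ _ _ (prodm leb leb) leb
    (fun p => (p.1.1, p.1.2 + g (p, d)))) => [|c /=].
    by apply: measurable_fun_pair => //; exact: measurable_funD n12 (m3 d).
  apply: (@preserving_snd _ _ _ _ _ leb leb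
    (fun p => p.2 + g (p, c, d))) => [|a /=].
    exact: measurable_funD measurable_snd (m2 c d).
  apply: (preserving_shear1 (g := fun b => g (a, b, c, d))) => b.
  by rewrite -(gi _ (- b)) /coords !mxE/= !mulr1 !mulr0 !addr0 subrr.
- rewrite [fun p => _](_ : _ =
      fun p => ((p.1.1, p.1.2 + g p), p.2)); last first.
    apply/funext => -[[[a b] c] d].
    by rewrite /coords !mxE/= !mulr1 !mulr0 !addr0.
  apply: (@preserving_fst _ _ _ _ _ (prodm (prodm leb leb) leb) leb
    (fun p => (p.1.1, p.1.2 + g p))) => [|d /=].
    apply: measurable_fun_pair; last exact: measurable_funD m12 mg.
    exact: measurableT_comp measurable_fst measurable_fst.
  apply: (@preserving_snd _ _ _ _ _ (prodm leb leb) leb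
    (fun p => p.2 + g (p, d))) => [|[a b] /=].
    exact: measurable_funD measurable_snd (m3 d).
  apply: (preserving_shear1 (g := fun c => g (a, b, c, d))) => c.
  by rewrite -(gi _ (- c)) /coords !mxE/= !mulr1 !mulr0 !addr0 subrr.
- rewrite [fun p => _](_ : _ =
      fun p => (p.1, p.2 + g p)); last first.
    apply/funext => -[[[a b] c] d].
    by rewrite /coords !mxE/= !mulr1 !mulr0 !addr0.
  apply: (@preserving_snd _ _ _ _ _ (prodm (prodm leb leb) leb) leb
    (fun p => p.2 + g p)) => [|[[a b] c] /=].
    exact: measurable_funD measurable_snd mg.
  apply: (preserving_shear1 (g := fun d => g (a, b, c, d))) => d.
  by rewrite -(gi _ (- d)) /coords !mxE/= !mulr1 !mulr0 !addr0 subrr.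
Qed.

Lemma preserving_translation4 (v : 'cV[R]_(1 + 3)) :
  preserving (@leb4 R) (fun p => coords (decoords p + v)).
Proof.
rewrite (matrix_sum_delta v).
apply: (big_ind (fun v =>
  preserving (@leb4 R) (fun p => coords (decoords p + v)))).
- rewrite [fun p => _](_ : _ = id); first by split; [exact: measurable_id|].
  by apply/funext => p; rewrite addr0 decoordsK.
- move=> u w pu pw.
  rewrite [fun p => _](_ : _ =
      (fun p => coords (decoords p + w)) \o (fun p => coords (decoords p + u))).
    exact: preserving_comp.
  by apply/funext => p; rewrite /= coordsK addrA.
move=> i _; rewrite big_ord1.
exact: (preserving_shear (g := fun=> v i 0)).
Qed.

Lemma preserving_SL4 (C : 'M[R]_(1 + 3)) : \det C = 1 ->
  preserving (@leb4 R) (fun p => coords (C *m decoords p)).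
Proof.
move: C; apply: SL_transvection_ind => [|A B pA pB|i j a ij].
- rewrite [fun p => _](_ : _ = id); first by split; [exact: measurable_id|].
  by apply/funext => p; rewrite mul1mx decoordsK.
- rewrite [fun p => _](_ : _ =
      (fun p => coords (A *m decoords p)) \o
      (fun p => coords (B *m decoords p))).
    exact: preserving_comp.
  by apply/funext => p; rewrite /= coordsK mulmxA.
(* The transvection adds [a] times coordinate [j] to coordinate [i]; as [i != j], the increment is
   independent of coordinate [i]. *)
rewrite [fun p => _](_ : _ =
    fun p => coords (decoords p + (a * decoords p j 0) *: delta_mx i 0)).
  apply: preserving_shear => [|p t].
    by apply: measurable_funM => //; exact: measurable_decoords.
  rewrite coordsK !mxE [j == i](_ : _ = false) ?mulr0 ?addr0//.
  by rewrite eq_sym (negPf ij).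
apply/funext => p; congr coords; rewrite mulmxDl mul1mx; congr (_ + _).
apply/colP => k; rewrite -scalemxAl !mxE (bigD1 j)//= big1.
  by rewrite !mxE !eqxx !andbT addr0 -mulrA; congr (_ * _); rewrite mulrC.
by move=> l /negPf lj; rewrite !mxE lj andbF mul0r.
Qed.

End shear.

(** * Entrywise measurability of matrix-valued functions *)

Section measurable_matrix.
Context d (T : measurableType d) (R : realType).

Definition mx_measurable m n (F : T -> 'M[R]_(m, n)) : Prop :=
  forall i j, measurable_fun setT (fun t => F t i j).

Lemma mx_measurableD m n (F G : T -> 'M[R]_(m, n)) :
  mx_measurable F -> mx_measurable G -> mx_measurable (fun t => F t + G t).
Proof.
by move=> mF mG i j; under eq_fun do rewrite mxE; exact: measurable_funD.
Qed.

Lemma mx_measurableZ m n (f : T -> R) (F : T -> 'M[R]_(m, n)) :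
  measurable_fun setT f -> mx_measurable F ->
  mx_measurable (fun t => f t *: F t).
Proof.
by move=> mf mF i j; under eq_fun do rewrite mxE; exact: measurable_funM.
Qed.

Lemma mx_measurableM m n p (F : T -> 'M[R]_(m, n)) (G : T -> 'M[R]_(n, p)) :
  mx_measurable F -> mx_measurable G -> mx_measurable (fun t => F t *m G t).
Proof.
move=> mF mG i j; under eq_fun do rewrite mxE.
by apply: measurable_sum => k; exact: measurable_funM.
Qed.

Lemma measurable_det n (F : T -> 'M[R]_n) :
  mx_measurable F -> measurable_fun setT (fun t => \det (F t)).
Proof.
move=> mF; rewrite /determinant; apply: measurable_sum => s.
by apply: measurable_funM => //; apply: measurable_prod => i _.
Qed.

Lemma mx_measurable_adj n (F : T -> 'M[R]_n) :
  mx_measurable F -> mx_measurable (fun t => \adj (F t)).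
Proof.
move=> mF i j; under eq_fun do rewrite mxE /cofactor.
apply: measurable_funM => //; apply: measurable_det => k l.
by under eq_fun do rewrite !mxE; exact: mF.
Qed.

(** Inversion is continuous on the open set of nonzero reals, and any function is measurable on the
    remaining point 0. *)
Lemma measurable_inv (f : T -> R) : measurable_fun setT f ->
  measurable_fun setT (fun t => (f t)^-1).
Proof.
move=> mf; apply: (@measurableT_comp _ _ _ _ _ _ (fun x : R => x^-1)) => //.
have -> : [set: R] = [set x | x != 0] `|` [set 0].
  by apply/seteqP; split=> x //= _; have [->|] := eqVneq x 0; [right|left].
have o0 : open [set x : R | x != 0].
  have -> : [set x : R | x != 0] = ~` [set 0].
    by apply/seteqP; split=> x /= /eqP.
  by apply: closed_openC; exact: closed_eq.
apply/measurable_funU;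
  [exact: open_measurable|exact: measurable_set1|split]; last first.
  exact: measurable_fun_set1.
apply: open_continuous_measurable_fun => // x; rewrite inE/= => x0.
exact: inv_continuous.
Qed.

(** An open set is a countable union of balls with rational centres and radii [1 / (k + 1)], and a
    ball is a finite intersection of conditions on single entries. *)
Lemma measurable_preimage_open m n (F : T -> 'M[R]_(m, n))
    (U : set 'M[R]_(m, n)) :
  mx_measurable F -> open U -> measurable (F @^-1` U).
Proof.
move=> mF oU.
pose B (q : 'M[rat]_(m, n) * nat) :=
  ball (map_mx ratr q.1 : 'M[R]_(m, n)) (q.2.+1%:R^-1 : R).
have mB q : measurable (F @^-1` B q).
  have -> : F @^-1` B q = \bigcap_(ij in [set: 'I_m * 'I_n])
      (fun t => F t ij.1 ij.2) @^-1`
        ball (ratr (q.1 ij.1 ij.2) : R) (q.2.+1%:R^-1 : R).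
    apply/seteqP; split=> t /=.
      by move=> [_ Bt] [i j] _ /=; have := Bt i j; rewrite mxE.
    by move=> Bt; split=> // i j; rewrite mxE; exact: (Bt (i, j)).
  apply: fin_bigcap_measurable => // ij _.
  apply: measurable_preimage (mF _ _) _; exact: measurable_ball.
(* Balls not contained in [U] are replaced by the empty set, so that the union ranges over a whole
   countable type. *)
have -> : F @^-1` U =
    \bigcup_q F @^-1` (if `[< B q `<=` U >] then B q else set0).
  apply/seteqP; split=> [t /= Ut|t [q _]]; last first.
    by case: ifPn => [/asboolP|_ []]; exact.
  have [e /= e0 eU] : nbhs_ball (F t) U.
    by apply/nbhs_ballP; exact: open_nbhs_nbhs.
  (* The radius is below [e / 2]: a ball of that radius whose centre is that close to [F t] stays
     within [e] of [F t]. *)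
  have [k _ /(_ _ (leqnn _)) ke] :=
    near_infty_natSinv_lt (PosNum (divr_gt0 e0 (ltr0Sn R 1))).
  have qP i j : exists q : rat, `|F t i j - ratr q| < k.+1%:R^-1.
    have [|q] := @rat_in_itvoo R (F t i j - k.+1%:R^-1) (F t i j + k.+1%:R^-1).
      by rewrite ltrD2l gtrN// invr_gt0 ltr0Sn.
    by rewrite in_itv/= => Fq; exists q; rewrite ltr_distlC.
  pose q : 'M[rat]_(m, n) := \matrix_(i, j) sval (cid (qP i j)).
  have Bq : B (q, k) (F t).
    split=> // i j; rewrite !mxE.
    by rewrite /ball/= distrC; case: cid.
  exists (q, k) => //; rewrite /= asboolT// => x Bx; apply: eU.
  have le_e (a b : 'M[R]_(m, n)) :
      ball a (k.+1%:R^-1 : R) b -> ball a (e / 2) b.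
    by apply: le_ball; exact: ltW.
  rewrite (splitr e); apply: ball_triangle (le_e _ _ Bx).
  exact/ball_sym/le_e.
apply: countable_bigcupT_measurable => [|q].
  exact: countableP.
by case: ifPn => _; [exact: mB|rewrite preimage_set0].
Qed.

End measurable_matrix.

(** * Skew-symmetry and continuity of the fields *)

Lemma skew_hatmx (R : realType) (b : 'cV[R]_3) : (hatmx b)^T = - hatmx b.
Proof.
have I3 (k : 'I_3) : [\/ k = 0, k = 1 | k = 2%:R].
  by case: k => [[|[|[|//]]] ?]; [constructor 1|constructor 2|constructor 3];
    exact: val_inj.
(* Index arithmetic modulo 3, by which the nine entries are compared. *)
have addE : (((1 + 1)%R = 2%:R :> 'I_3) * ((1 + 2%:R)%R = 0 :> 'I_3) *
    ((2%:R + 1)%R = 0 :> 'I_3) * ((2%:R + 2%:R)%R = 1 :> 'I_3))%type.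
  by do !split; exact: val_inj.
have neqE : (((0 == 1 :> 'I_3) = false) * ((0 == 2%:R :> 'I_3) = false) *
    ((1 == 0 :> 'I_3) = false) * ((1 == 2%:R :> 'I_3) = false) *
    ((2%:R == 0 :> 'I_3) = false) * ((2%:R == 1 :> 'I_3) = false))%type by [].
apply/matrixP => i j; rewrite !mxE.
have [->|->|->] := I3 i; have [->|->|->] := I3 j;
  by rewrite !(add0r, addE, eqxx, neqE, mulr0, mulr1, subr0, oppr0, opprK).
Qed.

(** A one-term list in [smooth] makes the first derivative differentiable, hence continuous. *)
Lemma continuous_partial (R : realType) (f : 'cV[R]_3 -> R) (j : 'I_3) :
  smooth (f : 'cV[R]_3 -> R^o) -> continuous (partial j f).
Proof.
move=> sf x; exact: differentiable_continuous (sf [:: delta_mx j 0] x).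
Qed.

Lemma continuous_partial_coord (R : realType) (f : 'cV[R]_3 -> 'cV[R]_3)
    (j k : 'I_3) :
  smooth f -> continuous (partial j (fun y => f y k 0)).
Proof.
move=> sf.
(* Smoothness concerns the vector-valued map, so the partial derivative of a component is rewritten
   as a component of the directional derivative. *)
have -> : partial j (fun y => f y k 0) = fun x => 'D_(delta_mx j 0) f x k 0.
  apply/funext => x; rewrite derive_mx ?mxE//.
  exact: diff_derivable (sf [::] x).
move=> x; apply: (@continuous_comp _ _ _ (fun x => 'D_(delta_mx j 0) f x)
  (fun M : 'cV[R]_3 => M k 0)).
  exact: differentiable_continuous (sf [:: delta_mx j 0] x).
exact: coord_continuous.
Qed.

(** * The one-step map and its inverse through the Cayley transform *)

Section leapfrog.
Variables (R : realType) (phi : 'cV[R]_3 -> R) (A : 'cV[R]_3 -> 'cV[R]_3).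
Variable h : R.
Hypotheses (sphi : smooth (phi : 'cV[R]_3 -> R^o)) (sA : smooth A).
Local Notation R1 := (measurableTypeR R).
Local Notation R4 := (R1 * R1 * R1 * R1)%type.
Local Notation V := 'cV[R]_(1 + 3).
Local Notation M := (Mmx R).
Local Notation K x := ((h / 2) *: Fmx phi A x).

Lemma skew_Fmx (x : V) : (Fmx phi A x)^T = - Fmx phi A x.
Proof.
rewrite /Fmx tr_block_mx opp_block_mx trmx0 oppr0 opprK.
have trN p q (B : 'M[R]_(p, q)) : (- B)^T = - B^T.
  by apply/matrixP => i j; rewrite !mxE.
by rewrite !trN trmxK skew_hatmx opprK.
Qed.

Lemma det_leapfrog (x : V) : \det (M + K x) = \det (M - K x).
Proof.
rewrite -det_tr linearD linearZ/= skew_Fmx scalerN; congr (\det (_ + _)).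
exact: tr_diag_mx.
Qed.

Lemma measurable_Fmx d (T : measurableType d) (f : T -> V) :
  mx_measurable f -> mx_measurable (fun t => Fmx phi A (f t)).
Proof.
move=> mf.
have md : mx_measurable (fun t => dsubmx (f t)).
  by move=> i j; under eq_fun do rewrite mxE; exact: mf.
have mc (g : 'cV[R]_3 -> R) :
    continuous g -> measurable_fun setT (fun t => g (dsubmx (f t))).
  (* Open intervals generate the Borel sets, and their preimages under the continuous [g] are
     open. *)
  move=> cg; apply: (measurability _ (RGenOpens.measurableE R)).
  move=> _ [_ [a [b ->] <-]]; rewrite setTI.
  apply: (measurable_preimage_open (U := g @^-1` `]a, b[) md).
  by move/continuousP : cg; apply; exact: interval_open.
have mE i : measurable_fun setT (fun t => Efield phi (dsubmx (f t)) i 0).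
  under eq_fun do rewrite !mxE; apply: measurable_funN => //.
  by apply: mc; exact: continuous_partial.
have mB i : measurable_fun setT (fun t => Bfield A (dsubmx (f t)) i 0).
  under eq_fun do rewrite !mxE.
  by apply: measurable_funB; apply: mc; exact: continuous_partial_coord.
move=> i j; rewrite /Fmx /block_mx.
case: (split_ordP i) => i' ->; case: (split_ordP j) => j' ->.
- by under eq_fun do rewrite col_mxEu row_mxEl mxE; exact: measurable_cst.
- rewrite (ord1 i'); under eq_fun do rewrite col_mxEu row_mxEr mxE [_^T _ _]mxE.
  exact: measurable_funN.
- rewrite (ord1 j'); under eq_fun do rewrite col_mxEd row_mxEl.
  exact: mE.
under eq_fun do rewrite col_mxEd row_mxEr mxE mxE mxE.
apply: measurable_funN => //.
by apply: measurable_funB; apply: measurable_funM.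
Qed.

(* The inverse of the Cayley transform [(M - K)^-1 (M + K)], written with the
   adjugate so that its entries are visibly measurable, and extended by the
   identity outside the domain of the method. *)
Definition cayley_inv (x : V) : 'M[R]_(1 + 3) :=
  if \det (M + K x) == 0 then 1%:M
  else (\det (M + K x))^-1 *: (\adj (M + K x) *m (M - K x)).

Lemma cayley_invE (x : V) : M - K x \in unitmx ->
  (M + K x \in unitmx) /\ cayley_inv x = invmx (M + K x) *m (M - K x).
Proof.
rewrite !unitmxE -det_leapfrog -unitmxE => xu; split=> //.
move: (xu); rewrite unitmxE unitfE => /negPf d0.
by rewrite /cayley_inv d0 /invmx xu scalemxAl.
Qed.

Lemma det_cayley_inv (x : V) : \det (cayley_inv x) = 1.
Proof.
have [d0|d0] := eqVneq (\det (M + K x)) 0.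
  by rewrite /cayley_inv d0 eqxx det1.
have [|_ ->] := @cayley_invE x; first by rewrite unitmxE -det_leapfrog unitfE.
by rewrite det_mulmx det_inv -det_leapfrog mulVf.
Qed.

Lemma measurable_cayley_inv d (T : measurableType d) (f : T -> V) :
  mx_measurable f -> mx_measurable (fun t => cayley_inv (f t)).
Proof.
move=> mf.
(* The values 1 and -1 of [c] give the two matrices of the Cayley transform. *)
have mK c : mx_measurable (fun t => M + c *: K (f t)).
  apply: mx_measurableD => [i j|]; first exact: measurable_cst.
  by do 2 apply: mx_measurableZ => //; exact: measurable_Fmx.
have mP : mx_measurable (fun t => M + K (f t)).
  by move=> i j; under eq_fun do rewrite -[K _]scale1r; exact: mK.
have mN : mx_measurable (fun t => M - K (f t)).
  by move=> i j; under eq_fun do rewrite -scaleN1r; exact: mK.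
move=> i j; rewrite /cayley_inv.
under eq_fun do rewrite (fun_if (fun B : 'M[R]__ => B i j)).
apply: measurable_fun_ifT.
- by apply: measurable_fun_eqr; [exact: measurable_det|exact: measurable_cst].
- exact: measurable_cst.
apply: mx_measurableZ; first by apply: measurable_inv; exact: measurable_det.
by apply: mx_measurableM mN; exact: mx_measurable_adj.
Qed.

(** The step reads [(M - K) q.2 = (M + K) p.2]. It can be solved backwards explicitly, because the
    old position [q.1 - h *: q.2], at which [K] is evaluated, is known from [q]. *)
Lemma leapfrog_stepE (p q : V * V) : M - K p.1 \in unitmx ->
  leapfrog_step phi A h p q <->
  p = (q.1 - h *: q.2, cayley_inv (q.1 - h *: q.2) *m q.2).
Proof.
move=> pu; have [Pu Ginv] := cayley_invE pu.
have stepE : M *m (q.2 - p.2) = (h / 2) *: (Fmx phi A p.1 *m (q.2 + p.2)) <->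
    (M - K p.1) *m q.2 = (M + K p.1) *m p.2.
  rewrite mulmxBr mulmxDr scalerDr mulmxBl mulmxDl -!scalemxAl.
  by split=> /eqP; rewrite -subr_eq0 opprD addrACA -opprD subr_eq0 => /eqP.
split=> [[/stepE e q1]|pq].
  have p1 : q.1 - h *: q.2 = p.1 by rewrite q1 addrK.
  by rewrite p1 Ginv -mulmxA e mulKmx//; case: (p).
have p1 : q.1 - h *: q.2 = p.1 by rewrite [in RHS]pq.
have p2 : cayley_inv p.1 *m q.2 = p.2 by rewrite [in RHS]pq -p1.
by split; [apply/stepE; rewrite -p2 Ginv -mulmxA mulKVmx|rewrite -p1 subrK].
Qed.

(** Since [leapfrog] is a choice among the solutions of the step relation, existence and uniqueness
    of the solution are what has to be shown. *)
Lemma leapfrogE (p q : V * V) : M - K p.1 \in unitmx ->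
  leapfrog phi A h p = q <->
  p = (q.1 - h *: q.2, cayley_inv (q.1 - h *: q.2) *m q.2).
Proof.
move=> pu; rewrite -leapfrog_stepE//.
have step_uniq q1 q2 : leapfrog_step phi A h p q1 ->
    leapfrog_step phi A h p q2 -> q1 = q2.
  have [Pu Ginv] := cayley_invE pu.
  have rec q' : leapfrog_step phi A h p q' ->
      q'.2 = invmx (M - K p.1) *m ((M + K p.1) *m p.2).
    move=> /(leapfrog_stepE _ pu) pq'.
    have p1 : q'.1 - h *: q'.2 = p.1 by rewrite [in RHS]pq'.
    have p2 : cayley_inv p.1 *m q'.2 = p.2 by rewrite [in RHS]pq' -p1.
    by rewrite -p2 Ginv -mulmxA mulKVmx// mulKmx.
  move=> s1 s2; move: (rec _ s1) (rec _ s2) s1.2 s2.2 => e1 e2.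
  rewrite e1 e2 => f1 f2.
  by rewrite (surjective_pairing q1) (surjective_pairing q2) e1 e2 f1 f2.
split=> [<-|s]; last by apply: get_unique => // q' s'; exact: step_uniq s' s.
apply: (getPex (P := [set q | leapfrog_step phi A h p q])).
(* The new momentum, obtained by solving the linear system forwards. *)
pose w := invmx (M - K p.1) *m ((M + K p.1) *m p.2).
exists (p.1 + h *: w, w) => /=; apply/leapfrog_stepE => //=.
have [Pu Ginv] := cayley_invE pu.
by rewrite addrK Ginv /w -mulmxA mulKVmx// mulKmx//; case: (p).
Qed.

(** The inverse step in coordinates, total because [cayley_inv] is. *)
Definition leapfrog_inv (y : R4 * R4) : R4 * R4 :=
  let x := decoords y.1 - h *: decoords y.2 in
  (coords x, coords (cayley_inv x *m decoords y.2)).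

Lemma preserving_leapfrog_inv :
  preserving (@leb4 R \x @leb4 R)%E leapfrog_inv.
Proof.
have m1 i : measurable_fun setT (fun y : R4 * R4 => decoords y.1 i 0).
  exact: measurableT_comp (measurable_decoords _) measurable_fst.
have m2 i : measurable_fun setT (fun y : R4 * R4 => decoords y.2 i 0).
  exact: measurableT_comp (measurable_decoords _) measurable_snd.
(* For a fixed momentum [T] translates the position; for a fixed position [S] acts on the momentum
   with determinant 1. *)
pose S (y : R4 * R4) :=
  (y.1, coords (cayley_inv (decoords y.1) *m decoords y.2)).
pose T (y : R4 * R4) := (coords (decoords y.1 - h *: decoords y.2), y.2).
have -> : leapfrog_inv = S \o T.
  by apply/funext => y; rewrite /S /T /leapfrog_inv /= coordsK.
apply: preserving_comp.
  apply: (@preserving_snd _ _ _ _ _ (@leb4 R) (@leb4 R)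
    (fun y => coords (cayley_inv (decoords y.1) *m decoords y.2))) => [|x /=].
    apply: measurable_coords => i; apply: mx_measurableM => [|k j].
      by apply: measurable_cayley_inv => k j; rewrite ord1.
    by rewrite ord1.
  by apply: preserving_SL4; exact: det_cayley_inv.
apply: (@preserving_fst _ _ _ _ _ (@leb4 R) (@leb4 R)
  (fun y => coords (decoords y.1 - h *: decoords y.2))) => [|u /=].
  apply: measurable_coords => i.
  under eq_fun do rewrite mxE [X in _ + X]mxE [X in _ - X]mxE.
  by apply: measurable_funB => //; exact: measurable_funM.
exact: preserving_translation4.
Qed.

End leapfrog.

(** * From preimages under the inverse to volumes of images *)

Lemma measurable_coords_open (R : realType)
    (Omega : set ('cV[R]_(1 + 3) * 'cV[R]_(1 + 3))) :
  open Omega -> measurable [set (coords p.1, coords p.2) | p in Omega].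
Proof.
move=> oO.
(* Position and momentum become the two columns of one matrix, so that the result on preimages of
   open sets of matrices applies. *)
have -> : [set (coords p.1, coords p.2) | p in Omega] =
    (fun y => row_mx (decoords y.1) (decoords y.2)) @^-1`
    [set w : 'M[R]_(1 + 3, 1 + 1) | Omega (lsubmx w, rsubmx w)].
  apply/seteqP; split=> [_ [[x u] Oxu <-]|y /=].
    by rewrite /= row_mxKl row_mxKr !coordsK.
  rewrite row_mxKl row_mxKr => Oy; exists (decoords y.1, decoords y.2) => //.
  by rewrite /= !decoordsK; case: y {Oy}.
apply: measurable_preimage_open => [i j|].
  case: (split_ordP j) => k ->; rewrite (ord1 k).
    under eq_fun do rewrite row_mxEl.
    exact: measurableT_comp (measurable_decoords _) measurable_fst.
  under eq_fun do rewrite row_mxEr.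
  exact: measurableT_comp (measurable_decoords _) measurable_snd.
have cpair : continuous (fun w : 'M[R]_(1 + 3, 1 + 1) => (lsubmx w, rsubmx w)).
  move=> w.
  apply: (@cvg_pair _ _ _ (nbhs w) (nbhs (lsubmx w)) (nbhs (rsubmx w))).
    exact: continuous_lsubmx.
  exact: continuous_rsubmx.
by move/continuousP : cpair; apply.
Qed.

Theorem theorem3p2 (R : realType) (phi : 'cV[R]_3 -> R)
    (A : 'cV[R]_3 -> 'cV[R]_3) (h : R) :
  smooth (phi : 'cV[R]_3 -> R^o) -> smooth A -> 0 < h ->
  volume_preserving (leapfrog_dom phi A h) (leapfrog phi A h).
Proof.
move=> sphi sA _ Omega oO _ OD; rewrite /vol.
have mO := measurable_coords_open oO.
have [minv pinv] := preserving_leapfrog_inv h sphi sA.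
(* A point [y] of the preimage is sent by the inverse into [Omega], hence into the domain of the
   method, where [leapfrogE] identifies it as an image; the extension of [cayley_inv] thus adds no
   points. *)
have -> : [set (coords p.1, coords p.2) | p in leapfrog phi A h @` Omega] =
    leapfrog_inv phi A h @^-1` [set (coords p.1, coords p.2) | p in Omega].
  apply/seteqP; split=> [_ [_ [p Op <-] <-]|y [p Op /= py]].
    have pE := (leapfrogE (leapfrog phi A h p) (OD _ Op)).1 erefl.
    by exists p => //; rewrite /leapfrog_inv/= !coordsK {1 2}pE.
  have pE : p = (decoords y.1 - h *: decoords y.2,
     cayley_inv phi A h (decoords y.1 - h *: decoords y.2) *m decoords y.2).
    move/(congr1 (fun z => (decoords z.1, decoords z.2))) : py.
    by rewrite /= !coordsK -surjective_pairing.
  exists (decoords y.1, decoords y.2); last by rewrite /= !decoordsK; case: (y).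
  exists p => //; apply/leapfrogE => //; exact: OD.
(* Both sets are measurable, and on measurable sets the outer measure is the product measure. *)
transitivity ((@leb4 R \x @leb4 R)%E
    (leapfrog_inv phi A h @^-1` [set (coords p.1, coords p.2) | p in Omega])).
  by apply: measurable_mu_extE; exact: measurable_preimage.
by rewrite pinv//; apply/esym/measurable_mu_extE.
Qed.
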